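(* Let $\kappa,\sigma$ be positive integers and $u,v>0$ real numbers. For each positive integer $N$ put $a_N=\kappa+\frac{2^{\kappa+\sigma}}{uN^{\kappa}}$ and $b_N=\sigma+\frac{2^{\kappa+\sigma}}{vN^{\sigma}}$. Then, for $n$ a nonnegative integer, $$\lim_{N\to\infty}\frac{uv\;h_n^{\kappa,\sigma;\,a_N,b_N,N}\!\left(\frac{(1-x)N}{2}\right)}{(n+1)_\kappa(n+\sigma-1)_\kappa(n+1)_\sigma(n+\kappa-1)_\sigma}=P_n^{u,v;\,\kappa,\sigma}(x),$$ where $h_n^{\kappa,\sigma;\,a,b,N}$ are the Krall Hahn polynomials and $P_n^{u,v;\,\kappa,\sigma}$ the Krall Jacobi polynomials, both defined in the context.
   Context: $(y)_j=y(y+1)\cdots(y+j-1)$ is the Pochhammer symbol; binomials with real upper entry are generalized. Jacobi polynomials: $P_n^{\alpha,\beta}(x)=2^{-n}\sum_{j=0}^n\binom{n+\alpha}{j}\binom{n+\beta}{n-j}(x-1)^{n-j}(x+1)^j$ for $n\ge0$; $P_{-1}^{\alpha,\beta}=P_{-2}^{\alpha,\beta}=0$. Krall Jacobi polynomials (Dirac deltas at $\pm1$): for positive integers $\kappa,\sigma$ and $u,v>0$, $$P_n^{u,v;\,\kappa,\sigma}(x)=\begin{vmatrix} P_n^{\kappa,\sigma}(x)&P_{n-1}^{\kappa,\sigma}(x)&P_{n-2}^{\kappa,\sigma}(x)\\ u+\frac{T_\sigma^\kappa(n)}{(n+1)_\kappa}&\frac{un}{n+\kappa}+\frac{T_\sigma^\kappa(n-1)}{(n+1)_\kappa}&\frac{u(n-1)_2}{(n+\kappa-1)_2}+\frac{T_\sigma^\kappa(n-2)}{(n+1)_\kappa}\\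 v+\frac{T_\kappa^\sigma(n)}{(n+1)_\sigma}&\frac{-vn}{n+\sigma}-\frac{T_\kappa^\sigma(n-1)}{(n+1)_\sigma}&\frac{v(n-1)_2}{(n+\sigma-1)_2}+\frac{T_\kappa^\sigma(n-2)}{(n+1)_\sigma}\end{vmatrix},$$ where $T_\sigma^\kappa(n)=\frac{2^{\kappa+\sigma}\Gamma(\kappa)}{(n+\sigma+1)_\kappa}$ and $T_\kappa^\sigma(n)=\frac{2^{\kappa+\sigma}\Gamma(\sigma)}{(n+\kappa+1)_\sigma}$. (These are orthogonal with respect to $(1-x)^{\kappa-1}(1+x)^{\sigma-1}dx+\frac{\kappa!u}{2}\delta_1+\frac{\sigma!v}{2}\delta_{-1}$ on $[-1,1]$.) Hahn polynomials: for $N\ge n\ge0$, $N$ a positive integer, $h_n^{a,b,N}(x)=\frac{(a+1)_n}{n!}\,{}_3F_2\!\left(-n,-x,n+a+b+1;\,a+1,-N;\,1\right)=\frac1{n!}\sum_{j=0}^n\frac{(-n)_j(-x)_j(n+a+b+1)_j(a+j+1)_{n-j}}{(-N)_j\,j!}$; $h_{-1}^{a,b,N}=h_{-2}^{a,b,N}=0$. For real $w$: $\lambda_j^{w}(x)=\prod_{i=0}^{j-1}(x-i(w+i+1))$ and $\theta_x^{w}=x(x+w+1)$. Dual Hahn polynomials, for real parameters $A,B,M$: $R_n^{A,B,M}(x)=\sum_{j=0}^n\frac{(-n)_j(-M+j)_{n-j}(A+j+1)_{n-j}}{(-1)^j j!}\lambda_j^{A+B}(x)$. Set $S_k^{a,b,N}(n)=R_k^{-b,-a,a+b+N}(\theta_{-n-1}^{-a-b})$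 (so $S_k^{b,a,N}(n)=R_k^{-a,-b,a+b+N}(\theta_{-n-1}^{-a-b})$). Krall Hahn polynomials: for positive integers $\kappa,\sigma,N$, real $a>\kappa$, $b>\sigma$ and $0\le n\le N$, $$h_n^{\kappa,\sigma;\,a,b,N}(x)=\begin{vmatrix} h_n^{a,b,N}(x)&h_{n-1}^{a,b,N}(x)&h_{n-2}^{a,b,N}(x)\\ \frac{(n+b-1)_2}{(n+a+b-1)_2}S_\kappa^{b,a,N}(n)&\frac{n+b-1}{n+a+b-1}S_\kappa^{b,a,N}(n-1)&S_\kappa^{b,a,N}(n-2)\\ \frac{(n+a-1)_2}{(n+a+b-1)_2}S_\sigma^{a,b,N}(n)&-\frac{n+a-1}{n+a+b-1}S_\sigma^{a,b,N}(n-1)&S_\sigma^{a,b,N}(n-2)\end{vmatrix}.$$ (They are orthogonal with respect to $\sum_{x=0}^N(a-\kappa+1+x)_\kappa(N+b-\sigma+1-x)_\sigma\binom{a-\kappa-1+x}{x}\binom{N+b-\sigma-1-x}{N-x}\delta_x$.)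
   Formalization: The cases n = 0 with κ = 1 or σ = 1 are excluded: there the denominator (n+1)_κ(n+σ-1)_κ(n+1)_σ(n+κ-1)_σ vanishes and the determinant defining the Krall Jacobi polynomial has an undefined entry. *)

(* Defs.v *)
From HB Require Import structures.
From mathcomp Require Import all_boot all_order all_algebra.
From mathcomp Require Import all_classical all_reals all_analysis.

Set Implicit Arguments.
Unset Strict Implicit.
Unset Printing Implicit Defensive.

Import Order.TTheory GRing.Theory Num.Theory.
Import numFieldNormedType.Exports.

Local Open Scope ring_scope.

(* Rising factorial (y)_j. *)
Definition poch (R : realType) (y : R) (j : nat) : R :=
  \prod_(i < j) (y + i%:R).

(* Binomial coefficient with real upper entry. *)
Definition gbin (R : realType) (y : R) (j : nat) : R :=
  (\prod_(i < j) (y - i%:R)) / j`!%:R.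

Definition det3 (R : realType) (r0 r1 r2 : seq R) : R :=
  \det (\matrix_(i < 3, j < 3) (nth [::] [:: r0; r1; r2] i)`_j).

(* The degree is an integer, so that polynomials of negative degree, which
   occur in the determinants below when n < 2, vanish. *)
Definition jacobi (R : realType) (alpha beta : R) (n : int) (x : R) : R :=
  match n with
  | Posz m => 2 ^- m * \sum_(j < m.+1)
      gbin (m%:R + alpha) j * gbin (m%:R + beta) (m - j)
        * (x - 1) ^+ (m - j) * (x + 1) ^+ j
  | Negz _ => 0
  end.

(* jacobiT kappa sigma n is T_sigma^kappa(n); the upper index comes first.
   Gamma(kappa) = (kappa - 1)! since kappa is a positive integer. *)
Definition jacobiT (R : realType) (kappa sigma : nat) (n : R) : R :=
  2 ^+ (kappa + sigma) * (kappa.-1)`!%:R / poch (n + sigma%:R + 1) kappa.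

Definition krall_jacobi (R : realType) (u v : R) (kappa sigma n : nat)
    (x : R) : R :=
  let P := fun m : int => jacobi kappa%:R sigma%:R m x in
  let k : R := kappa%:R in
  let s : R := sigma%:R in
  let t : R := n%:R in
  det3
    [:: P n%:Z; P (n%:Z - 1); P (n%:Z - 2)]
    [:: u + jacobiT kappa sigma t / poch (t + 1) kappa;
        u * t / (t + k) + jacobiT kappa sigma (t - 1) / poch (t + 1) kappa;
        u * poch (t - 1) 2 / poch (t + k - 1) 2
          + jacobiT kappa sigma (t - 2) / poch (t + 1) kappa]
    [:: v + jacobiT sigma kappa t / poch (t + 1) sigma;
        - v * t / (t + s) - jacobiT sigma kappa (t - 1) / poch (t + 1) sigma;
        v * poch (t - 1) 2 / poch (t + s - 1) 2
          + jacobiT sigma kappa (t - 2) / poch (t + 1) sigma].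

(* The terminating 3F2 written out, with (a+1)_n / (a+1)_j simplified to
   (a+j+1)_(n-j); meaningful for n <= N, where (-N)_j != 0 for all j <= n. *)
Definition hahn (R : realType) (a b : R) (N : nat) (n : int) (x : R) : R :=
  match n with
  | Posz m => (m`!%:R)^-1 * \sum_(j < m.+1)
      poch (- m%:R) j * poch (- x) j * poch (m%:R + a + b + 1) j
        * poch (a + j%:R + 1) (m - j) / (poch (- N%:R) j * j`!%:R)
  | Negz _ => 0
  end.

Definition dhahn_lambda (R : realType) (w : R) (j : nat) (x : R) : R :=
  \prod_(i < j) (x - i%:R * (w + i%:R + 1)).

Definition dhahn_theta (R : realType) (w x : R) : R := x * (x + w + 1).

Definition dual_hahn (R : realType) (A B M : R) (n : nat) (x : R) : R :=
  \sum_(j < n.+1)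
    poch (- n%:R) j * poch (- M + j%:R) (n - j) * poch (A + j%:R + 1) (n - j)
      / ((-1) ^+ j * j`!%:R) * dhahn_lambda (A + B) j x.

(* S_k^{a,b,N}(t), for a real argument t. *)
Definition hahnS (R : realType) (a b : R) (N : nat) (k : nat) (t : R) : R :=
  dual_hahn (- b) (- a) (a + b + N%:R) k (dhahn_theta (- a - b) (- t - 1)).

Definition krall_hahn (R : realType) (kappa sigma : nat) (a b : R)
    (N n : nat) (x : R) : R :=
  let h := fun m : int => hahn a b N m x in
  let t : R := n%:R in
  det3
    [:: h n%:Z; h (n%:Z - 1); h (n%:Z - 2)]
    [:: poch (t + b - 1) 2 / poch (t + a + b - 1) 2 * hahnS b a N kappa t;
        (t + b - 1) / (t + a + b - 1) * hahnS b a N kappa (t - 1);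
        hahnS b a N kappa (t - 2)]
    [:: poch (t + a - 1) 2 / poch (t + a + b - 1) 2 * hahnS a b N sigma t;
        - ((t + a - 1) / (t + a + b - 1)) * hahnS a b N sigma (t - 1);
        hahnS a b N sigma (t - 2)].

(* Main.v *)
(** The limit is taken entrywise in the determinants. Each [3F2] term of
    [h_n((1 - x) N / 2)] is a quotient of two products of [j] factors of order
    [N], so [h_n] tends to the hypergeometric form of [P_n(x)], which agrees
    with the defining sum by the Chu-Vandermonde identity. Since [kappa - a_N] has
    order exactly [N ^- kappa], only the first and the last terms of the dual
    Hahn sum survive, and [S_kappa^(b,a,N)(t)] tends to
    [(t+1)_kappa (t+sigma+1)_kappa + Gamma(kappa) 2 ^ (kappa+sigma) / u]. The
    row prefactors then turn these limits, after multiplication by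
    [u / ((n+1)_kappa (n+sigma-1)_kappa)], into the entries of the Krall Jacobi
    determinant; the third row is the second with the roles of
    [(kappa, a, u)] and [(sigma, b, v)] exchanged. *)
Require Import Defs.
From HB Require Import structures.
From mathcomp Require Import all_boot all_order all_algebra.
From mathcomp Require Import all_classical all_reals all_analysis.
From mathcomp Require Import ring lra zify.

Import Order.TTheory GRing.Theory Num.Theory.
Import numFieldNormedType.Exports.

Local Open Scope classical_set_scope.
Local Open Scope ring_scope.

(** * Rising factorials and binomial identities *)

Lemma poch_recl (R : realType) (y : R) (j : nat) :
  poch y j.+1 = y * poch (y + 1) j.
Proof.
rewrite /poch big_ord_recl addr0; congr (_ * _).
by apply: eq_bigr => i _; rewrite -addrA -natr1 [1 + _]addrC.
Qed.

Lemma poch_recr (R : realType) (y : R) (j : nat) :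
  poch y j.+1 = poch y j * (y + j%:R).
Proof. by rewrite /poch big_ord_recr. Qed.

Lemma poch_shift (R : realType) (y : R) (j : nat) :
  y * poch (y + 1) j = poch y j * (y + j%:R).
Proof. by rewrite -poch_recl poch_recr. Qed.

(** Both sides are [poch y (i + j)], cut after [i] or after [j] factors. *)
Lemma poch_exchange (R : realType) (y : R) (i j : nat) :
  poch y i * poch (y + i%:R) j = poch y j * poch (y + j%:R) i.
Proof.
have pochD p q : poch y (p + q) = poch y p * poch (y + p%:R) q.
  elim: q => [|q IH]; first by rewrite addn0 /poch big_ord0 mulr1.
  by rewrite addnS !poch_recr IH natrD -mulrA addrA.
by rewrite -!pochD addnC.
Qed.

Lemma poch_gt0 (R : realType) (y : R) (j : nat) : 0 < y -> 0 < poch y j.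
Proof. by move=> y0; apply: prodr_gt0 => i _; rewrite ltr_pwDl. Qed.

Lemma poch_neq0 (R : realType) (y : R) (j : nat) : 0 < y -> poch y j != 0.
Proof. by move=> y0; rewrite lt0r_neq0// poch_gt0. Qed.

Lemma poch_nat (R : realType) (m j : nat) :
  poch (m%:R + 1) j = ('C(m + j, j) * j`!)%:R :> R.
Proof.
rewrite bin_ffact; elim: j m => [|j IH] m; first by rewrite /poch big_ord0.
by rewrite poch_recl natr1 IH -natrM -addSnnS ffactnSr addnK mulnC.
Qed.

Lemma poch_oppn (R : realType) (m j : nat) :
  poch (- m%:R) j = (-1) ^+ j * ('C(m, j) * j`!)%:R :> R.
Proof.
rewrite bin_ffact; elim: j => [|j IH]; first by rewrite /poch big_ord0 mul1r.
rewrite poch_recr IH ffactnSr exprSr -!mulrA; congr (_ * _).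
(* Truncated subtraction agrees with that of [R] only for [j <= m]; beyond, the falling factorial is
   already zero. *)
have [lejm|ltmj] := leqP j m; first by rewrite natrM natrB//; ring.
by rewrite (ffact_small ltmj) mul0n !mul0r mulr0.
Qed.

Lemma gbin_nat (R : realType) (m j : nat) : gbin (m%:R : R) j = 'C(m, j)%:R.
Proof.
have jN0 : j`!%:R != 0 :> R by rewrite pnatr_eq0 -lt0n fact_gt0.
rewrite /gbin; apply: (canLR (mulfK jN0)).
rewrite -natrM bin_ffact; elim: j {jN0} => [|j IH]; first by rewrite big_ord0.
rewrite big_ord_recr /= IH ffactnSr natrM.
have [lejm|ltmj] := leqP j m; first by rewrite natrB.
by rewrite (ffact_small ltmj) !mul0r.
Qed.

Lemma bin_trinomial (m i l : nat) : (i + l <= m)%N ->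
  ('C(m, i + l) * 'C(i + l, i) = 'C(m, i) * 'C(m - i, l))%N.
Proof.
move=> leilm.
have h1 := bin_fact leilm; have h2 := bin_fact (leq_addr l i).
have h3 : ('C(m, i) * (i`! * (m - i)`!) = m`!)%N by apply: bin_fact; lia.
have h4 : ('C(m - i, l) * (l`! * (m - i - l)`!) = (m - i)`!)%N by apply: bin_fact; lia.
have p : (0 < i`! * l`! * (m - (i + l))`!)%N by rewrite !muln_gt0 !fact_gt0.
apply/eqP; rewrite -(eqn_pmul2r p); apply/eqP.
rewrite addKn in h2; rewrite -subnDA in h4.
transitivity m`!; first by rewrite -h1 -h2; ring.
by rewrite -h3 -h4; ring.
Qed.

(** Trinomial revision pulls ['C(p, i)] out of the sum, and what remains is a Vandermonde
    convolution; the terms with [j < i] vanish. *)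
Lemma sum_bin_trinomial (p q m i : nat) : (i <= m <= p)%N ->
  (\sum_(j < m.+1) 'C(p, j) * 'C(j, i) * 'C(q, m - j)
     = 'C(p, i) * 'C(p - i + q, m - i))%N.
Proof.
case/andP=> leim lemp; rewrite -binomial.Vandermonde big_distrr /=.
rewrite -(big_mkord xpredT (fun j => 'C(p, j) * 'C(j, i) * 'C(q, m - j))%N).
rewrite -(big_mkord xpredT
  (fun j => 'C(p, i) * ('C(p - i, j) * 'C(q, m - i - j)))%N).
rewrite (big_cat_nat (n := i))//=; last by lia.
rewrite big_nat big1 ?add0n => [|j /andP[_ ltji]]; last first.
  by rewrite (bin_small ltji) muln0 mul0n.
rewrite -{1}[i]add0n big_addn (subSn leim); apply: eq_big_nat => j /andP[_ ltj].
rewrite addnC bin_trinomial ?subnDA ?mulnA//; lia.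
Qed.

(** * Hypergeometric form of the Jacobi polynomials *)

(** Both sides are expanded in powers of [y = (x - 1) / 2], using [(x + 1) / 2 = y + 1]. Integer
    parameters make all coefficients natural numbers, compared through [sum_bin_trinomial]. *)
Lemma jacobi_hypergeometric (R : realType) (p q m : nat) (x : R) :
  jacobi p%:R q%:R (Posz m) x =
  m`!%:R^-1 * \sum_(j < m.+1)
    poch (- m%:R) j * ((1 - x) / 2) ^+ j * poch (m%:R + p%:R + q%:R + 1) j
      * poch (p%:R + j%:R + 1) (m - j) / j`!%:R.
Proof.
have [y ->] : exists y, x = 2 * y + 1 by exists ((x - 1) / 2); field.
transitivity (\sum_(i < m.+1) y ^+ (m - i)
  * ('C(m + p, i) * 'C(m + p - i + (m + q), m - i))%:R).
  rewrite /jacobi mulr_sumr.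
  transitivity (\sum_(j < m.+1) \sum_(i < m.+1) y ^+ (m - i)
      * ('C(m + p, j) * 'C(j, i) * 'C(m + q, m - j))%:R).
    apply: eq_bigr => -[j /=]; rewrite ltnS => lejm _.
    rewrite -!natrD !gbin_nat.
    have -> : 2 * y + 1 + 1 = 2 * (y + 1) by ring.
    rewrite addrK.
    rewrite !exprMn (exprDn y 1 j).
    transitivity (('C(m + p, j) * 'C(m + q, m - j))%:R *
      \sum_(i < j.+1) (y ^+ (m - i) *+ 'C(j, i))).
      have -> : \sum_(i < j.+1) y ^+ (m - i) *+ 'C(j, i) =
          y ^+ (m - j) * \sum_(i < j.+1) (y ^+ (j - i) * 1 ^+ i) *+ 'C(j, i).
        rewrite mulr_sumr; apply: eq_bigr => -[i /=]; rewrite ltnS => leij _.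
        by rewrite expr1n mulr1 mulrnAr -exprD; congr (_ ^+ _ *+ _); lia.
      have -> : (2 : R) ^- m = (2 ^+ (m - j) * 2 ^+ j)^-1 by rewrite -exprD subnK.
      rewrite natrM.
      by field; rewrite !expf_neq0.
    rewrite mulr_sumr (big_ord_widen m.+1 (fun i => ('C(m + p, j) * 'C(m + q, m - j))%:R * (y ^+ (m - i) *+ 'C(j, i))))//.
    rewrite big_mkcond; apply: eq_bigr => i _ /=; case: ifPn => [_|].
      by rewrite -mulr_natr !natrM; ring.
    by rewrite -leqNgt => ltji; rewrite (bin_small ltji) muln0 mul0n mulr0.
  rewrite exchange_big; apply: eq_bigr => -[i /=]; rewrite ltnS => leim _.
  rewrite -mulr_sumr -natr_sum; congr (_ * _%:R).
  by apply: sum_bin_trinomial; lia.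
(* Reversal makes the exponent of [y] the index, as in the hypergeometric sum. *)
rewrite (reindex_inj rev_ord_inj) mulr_sumr; apply: eq_bigr => -[i /=].
rewrite ltnS subSS => leim _.
have -> : (1 - (2 * y + 1)) / 2 = -1 * y by field.
rewrite -!natrD !poch_nat poch_oppn exprMn !subKn//.
have -> : (m + p - (m - i) + (m + q) = m + p + q + i)%N by lia.
have -> : (p + i + (m - i) = m + p)%N by lia.
rewrite -(bin_fact leim) !natrM.
(* One sign comes from [poch (- m%:R) i], the other from [(1 - x) / 2 = - y]. *)
transitivity (((-1) ^+ i * (-1) ^+ i) * (y ^+ i * ('C(m + p, m - i)%:R * 'C(m + p + q + i, i)%:R)) : R).
  by rewrite -expr2 sqrr_sign mul1r.
have C0 : 'C(m, i)%:R != 0 :> R by rewrite pnatr_eq0 -lt0n bin_gt0.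
have F0 k : k`!%:R != 0 :> R by rewrite pnatr_eq0 -lt0n fact_gt0.
by field; rewrite C0 !F0.
Qed.

(** * Determinants and elementary limits *)

Lemma det3E (R : realType) (a b c d e f g h i : R) :
  det3 [:: a; b; c] [:: d; e; f] [:: g; h; i] =
  a * (e * i - f * h) - b * (d * i - f * g) + c * (d * h - e * g).
Proof.
rewrite /det3 (expand_det_row _ 0) !big_ord_recl big_ord0 /cofactor.
rewrite !(expand_det_row _ 0) !big_ord_recl !big_ord0 /cofactor !det_mx11 !mxE /=.
by rewrite /bump /=; ring.
Qed.

Lemma cvg_sumr (R : realType) (T I : Type) (F : set_system T) (FF : Filter F)
    (r : seq I) (P : pred I) (f : I -> T -> R) (l : I -> R) :
  (forall i, P i -> f i x @[x --> F] --> l i) ->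
  \sum_(i <- r | P i) f i x @[x --> F] --> \sum_(i <- r | P i) l i.
Proof. by apply: cvg_big; exact: add_continuous. Qed.

Lemma cvg_prodr (R : realType) (T I : Type) (F : set_system T) (FF : Filter F)
    (r : seq I) (P : pred I) (f : I -> T -> R) (l : I -> R) :
  (forall i, P i -> f i x @[x --> F] --> l i) ->
  \prod_(i <- r | P i) f i x @[x --> F] --> \prod_(i <- r | P i) l i.
Proof. by apply: cvg_big; exact: mul_continuous. Qed.

Lemma cvg_poch (R : realType) (T : Type) (F : set_system T) (FF : Filter F)
    (y : T -> R) (l : R) (j : nat) :
  y x @[x --> F] --> l -> poch (y x) j @[x --> F] --> poch l j.
Proof. by move=> yl; apply: cvg_prodr => i _; apply: cvgD yl (cvg_cst _). Qed.

Lemma cvg_invn (R : realType) : (n%:R^-1 : R) @[n --> \oo] --> 0.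
Proof. by rewrite -(cvg_shiftS (fun n => n%:R^-1 : R)); exact: cvg_harmonic. Qed.

Lemma cvg_invnX (R : realType) (j : nat) :
  (n%:R ^- j : R) @[n --> \oo] --> ((j == 0)%:R : R).
Proof.
case: j => [|j]; first by under eq_fun do rewrite expr0 invr1; exact: cvg_cst.
rewrite [X in _ --> X](_ : _ = \prod_(i < j.+1) (0 : R)); last first.
  by rewrite prodr_const card_ord expr0n.
under eq_fun do rewrite -exprVn -[j.+1]card_ord -prodr_const.
by apply: cvg_prodr => i _; exact: cvg_invn.
Qed.

Lemma cvg_natr_add_divXn (R : realType) (k : nat) (c : R) (a : nat -> R) :
  (0 < k)%N -> (forall N, a N = k%:R + c / N%:R ^+ k) ->
  a N @[N --> \oo] --> (k%:R : R).
Proof.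
case: k => // k _ aE; rewrite (funext aE) -[X in _ --> X]addr0.
rewrite -[X in _ + X](mulr0 c).
by apply: cvgD; [exact: cvg_cst|apply: cvgMl_tmp; exact: (@cvg_invnX R k.+1)].
Qed.

Lemma nbhs_infty_natr_neq0 (R : realType) : \forall n \near \oo, n%:R != 0 :> R.
Proof. by near=> n; rewrite pnatr_eq0 -lt0n; near: n; exact: nbhs_infty_gt.
Unshelve. all: by end_near. Qed.

(** Spreading the [j] powers of [n] over the [j] factors leaves [y n / n + i / n] in each, whose
    shift tends to zero. *)
Lemma cvg_poch_scaled (R : realType) (y : nat -> R) (l : R) (j : nat) :
  y n / n%:R @[n --> \oo] --> l ->
  poch (y n) j / n%:R ^+ j @[n --> \oo] --> l ^+ j.
Proof.
move=> yl.
have -> : l ^+ j = \prod_(i < j) l by rewrite prodr_const card_ord.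
have -> : (fun n => poch (y n) j / n%:R ^+ j) =
    fun n => \prod_(i < j) (y n / n%:R + i%:R * n%:R^-1).
  apply/funext => n; rewrite -exprVn -[X in _ ^+ X]card_ord -prodr_const.
  by rewrite -big_split /=; apply: eq_bigr => i _; rewrite mulrDl.
apply: cvg_prodr => i _; rewrite -[l]addr0 -(mulr0 i%:R).
by apply: cvgD yl _; apply: cvgMl_tmp; exact: cvg_invn.
Qed.

(** * Limits of the Hahn and dual Hahn polynomials *)

Lemma cvg_hahn (R : realType) (p q : nat) (a b : nat -> R) (m : int) (x : R) :
  a n @[n --> \oo] --> (p%:R : R) -> b n @[n --> \oo] --> (q%:R : R) ->
  hahn (a N) (b N) N m ((1 - x) * N%:R / 2) @[N --> \oo]
    --> jacobi p%:R q%:R m x.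
Proof.
move=> ap bq; case: m => m; last exact: cvg_cst.
rewrite jacobi_hypergeometric /hahn; apply: cvgMl_tmp; apply: cvg_sumr => -[j /= jm] _.
(* Numerator and denominator are the limits of the two scaled arguments, [- (1 - x) N / 2] and
   [- N], divided by [N]. *)
have -> : (1 - x) / 2 = - ((1 - x) / 2) / (- 1) :> R by field.
rewrite expr_div_n.
have -> : (fun N : nat => poch (- m%:R) j * poch (- ((1 - x) * N%:R / 2)) j *
    poch (m%:R + a N + b N + 1) j * poch (a N + j%:R + 1) (m - j) /
    (poch (- N%:R) j * j`!%:R)) = (fun N : nat => poch (- m%:R) j *
     (poch (- ((1 - x) * N%:R / 2)) j / poch (- N%:R) j) *
    poch (m%:R + a N + b N + 1) j * poch (a N + j%:R + 1) (m - j) / j`!%:R).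
  by apply/funext => N; rewrite invfM; ring.
have nN0 := nbhs_infty_natr_neq0 R.
apply: cvgMr_tmp; apply: cvgM; first apply: cvgM; first apply: cvgMl_tmp.
- have /near_eq_cvg : \forall N \near \oo,
     poch (- ((1 - x) * N%:R / 2)) j / N%:R ^+ j / (poch (- N%:R) j / N%:R ^+ j)
     = poch (- ((1 - x) * N%:R / 2)) j / poch (- N%:R) j :> R.
    near=> N; rewrite invf_div mulrA divfK// expf_neq0//.
    by near: N.
  move/cvg_trans; apply; apply: cvgM; last apply: cvgV.
  + apply: cvg_poch_scaled; apply: cvg_near_cst; near=> N.
    have n0 : N%:R != 0 :> R by near: N.
    by field.
  + by rewrite expf_neq0// oppr_eq0 oner_eq0.
  + apply: cvg_poch_scaled; apply: cvg_near_cst; near=> N.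
    by rewrite mulNr divff//; near: N.
- by apply: cvg_poch; do !apply: cvgD => //; exact: cvg_cst.
- by apply: cvg_poch; do !apply: cvgD => //; exact: cvg_cst.
Unshelve. all: by end_near. Qed.

(* Only the extreme terms of the sum survive: for [j < k], the factor
   [(- a N + j + 1)_(k - j)] contains [k - a N = - c / N ^ k], which beats
   [N ^ (k - j)] unless [j = 0]. *)
Lemma cvg_hahnS (R : realType) (k : nat) (s c t : R) (a b : nat -> R) :
  (0 < k)%N ->
  (forall N, a N = k%:R + c / N%:R ^+ k) ->
  b N @[N --> \oo] --> s ->
  hahnS (b N) (a N) N k t @[N --> \oo]
    --> poch (t + 1) k * poch (t + s + 1) k + k.-1`!%:R * c.
Proof.
case: k => // k _ aE bs.
have ak := cvg_natr_add_divXn _ _ _ _ (ltn0Sn k) aE.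
(* With [y = - t - 1] and [w = - a - b], the factor [y (y + w + 1) - i (w + i + 1)] splits as
   [(y - i) (y + w + i + 1)]. *)
pose L j := \prod_(i < j) ((t + 1 + i%:R) * (t + k.+1%:R + s - i%:R)).
have lambda_cvg j : dhahn_lambda (- a N - b N) j
    (dhahn_theta (- b N - a N) (- t - 1)) @[N --> \oo] --> L j.
  have -> : (fun N => dhahn_lambda (- a N - b N) j
    (dhahn_theta (- b N - a N) (- t - 1))) =
    (fun N => \prod_(i < j) ((t + 1 + i%:R) * (t + a N + b N - i%:R))).
    by apply/funext => N; apply: eq_bigr => i _; rewrite /dhahn_theta; ring.
  apply: cvg_prodr => i _; apply: cvgMl_tmp.
  by do !apply: cvgD => //; exact: cvg_cst.
have LE : L k.+1 = poch (t + 1) k.+1 * poch (t + s + 1) k.+1.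
  rewrite /L big_split /=; congr (_ * _).
  rewrite /poch (reindex_inj rev_ord_inj); apply: eq_bigr => -[i /= ik] _.
  by rewrite subSS natrB // -natr1; ring.
rewrite /hahnS /dual_hahn [X in _ --> X]addrC; under eq_fun do rewrite big_ord_recr/=.
apply: cvgD; last first.
  rewrite -LE -[L _]mul1r subnn.
  under eq_fun => N.
    rewrite poch_oppn binn mul1n /poch !big_ord0 !mulr1 divff; last first.
      by rewrite mulf_neq0 ?signr_eq0// pnatr_eq0 -lt0n fact_gt0.
    over.
  by apply: cvgM; [exact: cvg_cst|exact: lambda_cvg].
(* The constant is written as the sum of the termwise limits, with an indicator of [j = 0], so that
   convergence can be checked term by term. *)
have -> : k`!%:R * c = \sum_(j < k.+1) (poch (- k.+1%:R) j /
    ((-1) ^+ j * j`!%:R) * (-1) ^+ (k - j).+1 * (nat_of_ord j == 0%N)%:R *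
    (poch (- k.+1%:R + j%:R + 1) (k - j) * - c) * L j).
  rewrite big_ord_recl /= big1 ?addr0 => [|j _]; last by rewrite mulr0 !mul0r.
  have -> : - k.+1%:R + 1 = - k%:R :> R by rewrite -natr1; ring.
  rewrite subn0 (poch_oppn R k k) binn mul1n /L /poch !big_ord0 expr0 !mulr1 divr1 mul1r.
  rewrite exprS mulN1r mulNr !mulrN opprK !mulrA -expr2 sqrr_sign.
  by rewrite mul1r.
apply: cvg_sumr => -[j /=]; rewrite ltnS => lejk _.
(* Of the [k.+1] inverse powers of [N] in the small factor, [(k - j).+1] normalize the first rising
   factorial in [N]; the other [j] produce the indicator. *)
have -> : (fun N : nat => poch (- k.+1%:R) j *
    poch (- (b N + a N + N%:R) + j%:R) (k.+1 - j) *
    poch (- a N + j%:R + 1) (k.+1 - j) / ((-1) ^+ j * j`!%:R) *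
    dhahn_lambda (- a N - b N) j (dhahn_theta (- b N - a N) (- t - 1))) =
  (fun N => poch (- k.+1%:R) j / ((-1) ^+ j * j`!%:R) *
    (poch (- (b N + a N + N%:R) + j%:R) (k - j).+1 / N%:R ^+ (k - j).+1) *
    N%:R ^- j * (poch (- a N + j%:R + 1) (k - j) * - c) *
    dhahn_lambda (- a N - b N) j (dhahn_theta (- b N - a N) (- t - 1))).
  apply/funext => N; rewrite subSn// [poch (- a N + _ + _) _]poch_recr.
  have -> : - a N + j%:R + 1 + (k - j)%:R = - c * (N%:R ^- (k - j).+1 * N%:R ^- j).
    rewrite -invfM -exprD aE natrB// addSn subnK// -natr1; ring.
  by ring.
apply: cvgM; last exact: lambda_cvg.
apply: cvgM; last first.
  apply: cvgMr_tmp; apply: cvg_poch.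
  by do !apply: cvgD; [exact: cvgN|exact: cvg_cst|exact: cvg_cst].
apply: cvgM; last exact: cvg_invnX.
apply: cvgMl_tmp; apply: cvg_poch_scaled.
have lin : (- b N - a N + j%:R) * N%:R^-1 - 1 @[N --> \oo] --> (-1 : R).
  rewrite -[X in _ --> X]add0r -[X in _ --> X - _](mulr0 (- s - k.+1%:R + j%:R)).
  apply: cvgD; last exact: cvg_cst.
  apply: cvgM; last exact: cvg_invn.
  by do !apply: cvgD; [exact: cvgN|exact: cvgN|exact: cvg_cst].
apply: cvg_trans lin; apply: near_eq_cvg; near=> N.
have n0 : N%:R != 0 :> R by near: N; exact: nbhs_infty_natr_neq0.
by field.
Unshelve. all: by end_near. Qed.

(** * Entries of the limiting rows *)

(** The limit in [cvg_hahnS] at [c = 2 ^ (k + s) / u], shared by the second and third rows. *)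
Definition hahnS_limit (R : realType) (k s : nat) (u t : R) : R :=
  poch (t + 1) k * poch (t + s%:R + 1) k + k.-1`!%:R * (2 ^+ (k + s) / u).

(** By [poch_exchange], the prefactor over [poch (t + s - 1) k] is the inverse of
    [poch (t + s + 1) k]; the two summands of [hahnS_limit] then give [u] and the [jacobiT] term. *)
Lemma row_limit0 (R : realType) (k s : nat) (u t : R) :
  (0 < k)%N -> (0 < s)%N -> u != 0 -> 0 <= t ->
  poch (t + s%:R - 1) k != 0 ->
  u * (poch (t + s%:R - 1) 2 / poch (t + k%:R + s%:R - 1) 2 * hahnS_limit _ k s u t)
    / (poch (t + 1) k * poch (t + s%:R - 1) k) =
  u + jacobiT k s t / poch (t + 1) k.
Proof.
rewrite -!(ler1n R) => k_ge1 s_ge1 u0 t_ge0 p0.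
have p10 : poch (t + 1) k != 0 by apply: poch_neq0; lra.
have E := poch_exchange _ (t + s%:R - 1) 2 k.
have e1 : t + s%:R - 1 + 2 = t + s%:R + 1 by ring.
have e2 : t + s%:R - 1 + k%:R = t + k%:R + s%:R - 1 by ring.
rewrite e1 e2 in E; rewrite /hahnS_limit /jacobiT.
have q0 : poch (t + s%:R + 1) k != 0.
  by apply: poch_neq0; lra.
have w0 : poch (t + k%:R + s%:R - 1) 2 != 0.
  by apply: poch_neq0; lra.
have -> : poch (t + s%:R - 1) 2 =
    poch (t + s%:R - 1) k * poch (t + k%:R + s%:R - 1) 2 / poch (t + s%:R + 1) k.
  by rewrite -E mulfK.
by field; rewrite u0 p0 p10 q0 w0.
Qed.

Lemma row_limit1 (R : realType) (k s : nat) (u t : R) :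
  (0 < k)%N -> (0 < s)%N -> u != 0 -> 0 <= t ->
  poch (t + s%:R - 1) k != 0 ->
  u * ((t + s%:R - 1) / (t + k%:R + s%:R - 1) * hahnS_limit _ k s u (t - 1))
    / (poch (t + 1) k * poch (t + s%:R - 1) k) =
  u * t / (t + k%:R) + jacobiT k s (t - 1) / poch (t + 1) k.
Proof.
rewrite -!(ler1n R) => k_ge1 s_ge1 u0 t_ge0 p0.
have p10 : poch (t + 1) k != 0 by apply: poch_neq0; lra.
have E := poch_shift _ (t + s%:R - 1) k.
have F := poch_shift _ t k.
have e1 : t + s%:R - 1 + k%:R = t + k%:R + s%:R - 1 by ring.
have e2 : t - 1 + s%:R + 1 = t + s%:R by ring.
rewrite subrK e1 in E; rewrite /hahnS_limit /jacobiT subrK e2.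
have q0 : poch (t + s%:R) k != 0.
  by apply: poch_neq0; lra.
have w0 : t + k%:R + s%:R - 1 != 0.
  by apply: lt0r_neq0; lra.
have tk0 : t + k%:R != 0.
  by apply: lt0r_neq0; lra.
have -> : poch t k = t * poch (t + 1) k / (t + k%:R) by rewrite F mulfK.
(* Generalized because it contains the [t + s%:R - 1] about to be rewritten. *)
move: (poch (t + s%:R - 1) k) p0 E => P p0 E.
have -> : t + s%:R - 1 = P * (t + k%:R + s%:R - 1) / poch (t + s%:R) k.
  by rewrite -E mulfK.
by field; rewrite u0 p0 p10 q0 w0 tk0.
Qed.

(** The [jacobiT] denominator already matches; [poch_exchange] turns the ratio of [poch (t - 1) k]
    to [poch (t + 1) k] into that of two products of length 2. *)
Lemma row_limit2 (R : realType) (k s : nat) (u t : R) :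
  (0 < k)%N -> (0 < s)%N -> u != 0 -> 0 <= t ->
  poch (t + s%:R - 1) k != 0 -> t + k%:R - 1 != 0 ->
  u * hahnS_limit _ k s u (t - 2) / (poch (t + 1) k * poch (t + s%:R - 1) k) =
  u * poch (t - 1) 2 / poch (t + k%:R - 1) 2
    + jacobiT k s (t - 2) / poch (t + 1) k.
Proof.
rewrite -!(ler1n R) => k_ge1 s_ge1 u0 t_ge0 p0.
have p10 : poch (t + 1) k != 0 by apply: poch_neq0; lra.
move=> tk0; have F := poch_exchange _ (t - 1) 2 k.
have e1 : t - 1 + 2 = t + 1 by ring.
have e2 : t - 1 + k%:R = t + k%:R - 1 by ring.
have e3 : t - 2 + 1 = t - 1 by ring.
have e4 : t - 2 + s%:R + 1 = t + s%:R - 1 by ring.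
rewrite e1 e2 in F; rewrite /hahnS_limit /jacobiT e3 e4.
have w0 : poch (t + k%:R - 1) 2 != 0.
  rewrite /poch !big_ord_recr big_ord0/= mul1r addr0 mulf_neq0//.
  by apply: lt0r_neq0; lra.
have -> : poch (t - 1) k = poch (t - 1) 2 * poch (t + 1) k / poch (t + k%:R - 1) 2.
  by rewrite F mulfK.
by field; rewrite u0 p0 p10 w0.
Qed.

(** * Passage to the limit in the determinants *)

Lemma cvg_det3 (R : realType) (T : Type) (F : set_system T) (FF : Filter F)
    (a b c d e f g h i : T -> R) (a' b' c' d' e' f' g' h' i' : R) :
  a x @[x --> F] --> a' -> b x @[x --> F] --> b' -> c x @[x --> F] --> c' ->
  d x @[x --> F] --> d' -> e x @[x --> F] --> e' -> f x @[x --> F] --> f' ->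
  g x @[x --> F] --> g' -> h x @[x --> F] --> h' -> i x @[x --> F] --> i' ->
  det3 [:: a x; b x; c x] [:: d x; e x; f x] [:: g x; h x; i x] @[x --> F]
    --> det3 [:: a'; b'; c'] [:: d'; e'; f'] [:: g'; h'; i'].
Proof.
move=> *; under eq_fun do rewrite det3E; rewrite det3E.
by apply: cvgD; [apply: cvgB|];
  (apply: cvgM => //; apply: cvgB; apply: cvgM).
Qed.

Theorem lemma3p4 (R : realType) (kappa sigma n : nat) (u v x : R)
    (kappa_gt0 : (0 < kappa)%N) (sigma_gt0 : (0 < sigma)%N)
    (u_gt0 : 0 < u) (v_gt0 : 0 < v) :
  let a := fun N : nat =>
    kappa%:R + 2 ^+ (kappa + sigma) / (u * N%:R ^+ kappa) in
  let b := fun N : nat =>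
    sigma%:R + 2 ^+ (kappa + sigma) / (v * N%:R ^+ sigma) in
  let D : R :=
    poch (n%:R + 1) kappa * poch (n%:R + sigma%:R - 1) kappa
      * poch (n%:R + 1) sigma * poch (n%:R + kappa%:R - 1) sigma in
  (* D = 0 only for n = 0 with kappa = 1 or sigma = 1 *)
  D != 0 ->
  (fun N : nat =>
     u * v * krall_hahn kappa sigma (a N) (b N) N n ((1 - x) * N%:R / 2) / D)
    @ \oo --> krall_jacobi u v kappa sigma n x.
Proof.
move=> a b D D0.
have aE N : a N = kappa%:R + 2 ^+ (kappa + sigma) / u / N%:R ^+ kappa.
  by rewrite /a invfM mulrA.
(* The exponent is commuted to fit [hahnS_limit] with the roles exchanged. *)
have bE N : b N = sigma%:R + 2 ^+ (sigma + kappa) / v / N%:R ^+ sigma.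
  by rewrite /b invfM mulrA addnC.
have acvg := cvg_natr_add_divXn _ _ _ _ kappa_gt0 aE.
have bcvg := cvg_natr_add_divXn _ _ _ _ sigma_gt0 bE.
have hahn_cvg m := cvg_hahn _ _ _ _ _ m x acvg bcvg.
have S1 y := cvg_hahnS _ _ _ _ y _ _ kappa_gt0 aE bcvg.
have S2 y := cvg_hahnS _ _ _ _ y _ _ sigma_gt0 bE acvg.
have := D0; rewrite !mulf_eq0 !negb_or -!andbA => /and4P[p1 p2 p3 p4].
(* Supplies the last hypothesis of [row_limit2]: each row gets it from the factor of [D] that
   belongs to the other row. *)
have first_neq0 y j : (0 < j)%N -> poch y j != 0 -> y != 0 :> R.
  by case: j => // j _; apply: contraNN => /eqP ->; rewrite poch_recl mul0r.
set t : R := n%:R.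
have t0 : 0 <= t by exact: ler0n.
have [u0 v0] : u != 0 /\ v != 0 by rewrite !lt0r_neq0.
have w_gt0 : 0 < t + kappa%:R + sigma%:R - 1.
  by move: kappa_gt0 sigma_gt0; rewrite -!(ler1n R); lra.
have q1 : (t + a N + b N - 1)^-1 @[N --> \oo] -->
    (t + kappa%:R + sigma%:R - 1)^-1.
  apply: cvgV; first exact: lt0r_neq0.
  by do !apply: cvgD => //; exact: cvg_cst.
have q2 : (poch (t + a N + b N - 1) 2)^-1 @[N --> \oo] -->
    (poch (t + kappa%:R + sigma%:R - 1) 2)^-1.
  apply: cvgV; first by rewrite lt0r_neq0// poch_gt0.
  by apply: cvg_poch; do !apply: cvgD => //; exact: cvg_cst.
have ta : t + a N - 1 @[N --> \oo] --> t + kappa%:R - 1.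
  by do !apply: cvgD => //; exact: cvg_cst.
have tb : t + b N - 1 @[N --> \oo] --> t + sigma%:R - 1.
  by do !apply: cvgD => //; exact: cvg_cst.
have e10 := row_limit0 _ _ _ _ _ kappa_gt0 sigma_gt0 u0 t0 p2.
have e11 := row_limit1 _ _ _ _ _ kappa_gt0 sigma_gt0 u0 t0 p2.
have e12 := row_limit2 _ _ _ _ _ kappa_gt0 sigma_gt0 u0 t0 p2
  (first_neq0 _ _ sigma_gt0 p4).
have e20 := row_limit0 _ _ _ _ _ sigma_gt0 kappa_gt0 v0 t0 p4.
have e21 := row_limit1 _ _ _ _ _ sigma_gt0 kappa_gt0 v0 t0 p4.
have e22 := row_limit2 _ _ _ _ _ sigma_gt0 kappa_gt0 v0 t0 p4
  (first_neq0 _ _ kappa_gt0 p2).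
have e21' : forall z T : R, - v * t / z - T = - (v * t / z + T).
  by move=> z T; rewrite opprD mulNr mulNr.
rewrite /krall_jacobi e21' -/t -e10 -e11 -e12 -e20 -e21 -e22.
rewrite -/t (addrAC t sigma%:R kappa%:R).
(* Multilinearity in the last two rows; the four row denominators multiply to [D]. *)
have detZ : forall (a b c d e f g h i p q r w : R),
    det3 [:: a; b; c] [:: u * d / (p * q); u * e / (p * q); u * f / (p * q)]
     [:: v * g / (r * w); - (v * h / (r * w)); v * i / (r * w)] =
    u * v * det3 [:: a; b; c] [:: d; e; f] [:: g; - h; i] / (p * q * r * w).
  by move=> *; rewrite !det3E !invfM; ring.
rewrite detZ -/D; apply: cvgMr_tmp; apply: cvgMl_tmp.
rewrite -[- (_ * hahnS_limit _ _ _ _ _)]mulNr /krall_hahn; cbv zeta.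
apply: cvg_det3; try exact: hahn_cvg; try exact: S1; try exact: S2.
- by apply: cvgM; [apply: cvgM; [apply: cvg_poch; exact: tb|exact: q2]|exact: S1].
- by apply: cvgM; [apply: cvgM; [exact: tb|exact: q1]|exact: S1].
- by apply: cvgM; [apply: cvgM; [apply: cvg_poch; exact: ta|exact: q2]|exact: S2].
- by apply: cvgM; [apply: cvgN; apply: cvgM; [exact: ta|exact: q1]|exact: S2].
Qed.
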